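(* Let $T>0$, let $\theta>0$ be fixed, let $S_1,G\in\mathbb R$ be constants, and let $A_1,B_1,D_1,A_2,B_2,D_2,\sigma,R_{11},R_{12},R_{14},R_{22},R_{24},R_{44}:[0,T]\to\mathbb R$ be deterministic and bounded functions with $R_{44}$ uniformly positive definite. Then there exists an interval $[T-\eta,T]\subseteq[0,T]$, $\eta>0$, such that the coupled system of risk-sensitive Riccati equations $$\begin{cases}\dot\alpha_1+2\mathcal C_1\alpha_1+2\mathcal C_2\beta_1+2\mathcal C_3\alpha_1\beta_1+\mathcal C_4\alpha_1^2+\mathcal C_5\beta_1^2+\mathcal C_6=0,&\alpha_1(T)=S_1,\\ \dot\beta_1+\mathcal C_{11}\beta_1-\mathcal C_{12}\alpha_1-\mathcal C_{13}\alpha_1\beta_1+\mathcal C_{14}\beta_1^2+\mathcal C_{15}=0,&\beta_1(T)=G,\end{cases}$$ has a unique solution $(\alpha_1,\beta_1)$ on $[T-\eta,T]$, where the coefficients $\mathcal C_i$ are given in the context.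
   Context: The coefficients are $$\mathcal C_1=A_1-R_{44}^{-1}D_1R_{14},\quad \mathcal C_2=R_{12}-R_{44}^{-1}R_{14}R_{24},\quad \mathcal C_3=B_1-R_{44}^{-1}D_1R_{24},\quad \mathcal C_4=\theta\sigma^2-R_{44}^{-1}D_1^2,$$ $$\mathcal C_5=R_{22}-R_{44}^{-1}R_{24}^2,\quad \mathcal C_6=R_{11}-R_{44}^{-1}R_{14}^2,\quad \mathcal C_{11}=A_1+B_2-R_{44}^{-1}(D_1R_{14}+D_2R_{24}),$$ $$\mathcal C_{12}=R_{44}^{-1}D_1D_2,\quad \mathcal C_{13}=R_{44}^{-1}D_1^2,\quad \mathcal C_{14}=B_1-R_{44}^{-1}D_1R_{24},\quad \mathcal C_{15}=A_2-R_{44}^{-1}D_2R_{14}.$$ All functions are evaluated at time $t$, and a dot denotes $d/dt$.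
   Formalization: The bounded coefficient functions are also assumed Lebesgue measurable (for a non-measurable R_11 no solution need exist), and ''solution'' means absolutely continuous functions satisfying the equations almost everywhere. *)

(* Defs.v *)
From HB Require Import structures.
From mathcomp Require Import all_boot all_order all_algebra.
From mathcomp Require Import all_classical all_reals all_analysis.

Set Implicit Arguments.
Unset Strict Implicit.
Unset Printing Implicit Defensive.

Import Order.TTheory GRing.Theory Num.Theory.
Import numFieldNormedType.Exports.

Local Open Scope classical_set_scope.
Local Open Scope ring_scope.

(* Lebesgue (not merely Borel) measurability on D: the source carries the
   Caratheodory sigma-algebra of the outer measure of interval length. *)
Definition lebesgue_measurable_fun (R : realType) (D : set R) (f : R -> R) :
    Prop :=
  @measurable_fun _ _
    (caratheodory_type (wlength (@idfun R))^*%mu)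
    (measurableTypeR R) D f.

Definition bounded_measurable (R : realType) (D : set R) (f : R -> R) : Prop :=
  lebesgue_measurable_fun D f /\ [bounded f t | t in D].

Definition abs_continuous (R : realType) (a b : R) (f : R -> R) : Prop :=
  forall e : R, 0 < e -> exists2 d : R, 0 < d &
    forall (n : nat) (u v : 'I_n -> R),
      (forall i, a <= u i <= v i /\ v i <= b) ->
      trivIset setT (fun i => [set` `]u i, v i[]) ->
      \sum_(i < n) (v i - u i) < d ->
      \sum_(i < n) `|f (v i) - f (u i)| < e.

Record riccati_data (R : realType) := RiccatiData {
  theta : R;
  A1 : R -> R; B1 : R -> R; D1 : R -> R;
  A2 : R -> R; B2 : R -> R; D2 : R -> R;
  sigma : R -> R;
  R11 : R -> R; R12 : R -> R; R14 : R -> R;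
  R22 : R -> R; R24 : R -> R; R44 : R -> R }.

Section Coefficients.
Variables (R : realType) (p : riccati_data R) (t : R).

Definition C1 : R := A1 p t - (R44 p t)^-1 * D1 p t * R14 p t.
Definition C2 : R := R12 p t - (R44 p t)^-1 * R14 p t * R24 p t.
Definition C3 : R := B1 p t - (R44 p t)^-1 * D1 p t * R24 p t.
Definition C4 : R := theta p * sigma p t ^+ 2 - (R44 p t)^-1 * D1 p t ^+ 2.
Definition C5 : R := R22 p t - (R44 p t)^-1 * R24 p t ^+ 2.
Definition C6 : R := R11 p t - (R44 p t)^-1 * R14 p t ^+ 2.
Definition C11 : R :=
  A1 p t + B2 p t - (R44 p t)^-1 * (D1 p t * R14 p t + D2 p t * R24 p t).
Definition C12 : R := (R44 p t)^-1 * D1 p t * D2 p t.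
Definition C13 : R := (R44 p t)^-1 * D1 p t ^+ 2.
Definition C14 : R := B1 p t - (R44 p t)^-1 * D1 p t * R24 p t.
Definition C15 : R := A2 p t - (R44 p t)^-1 * D2 p t * R14 p t.

End Coefficients.

(* As the coefficients are only bounded and measurable, a solution on [a, b] is
   meant in the sense of Caratheodory: absolutely continuous components that
   satisfy the differential equations almost everywhere. The values of alpha
   and beta outside [a, b] are irrelevant. *)
Definition riccati_solution (R : realType) (p : riccati_data R) (S1 G a b : R)
    (alpha beta : R -> R) : Prop :=
  [/\ abs_continuous a b alpha,
      abs_continuous a b beta,
      {ae (@lebesgue_measure R), forall t : R, t \in `]a, b[ ->
        [/\ derivable alpha t 1, derivable beta t 1,
            'D_1 alpha t + 2 * C1 p t * alpha t + 2 * C2 p t * beta t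
              + 2 * C3 p t * alpha t * beta t + C4 p t * alpha t ^+ 2
              + C5 p t * beta t ^+ 2 + C6 p t = 0
          & 'D_1 beta t + C11 p t * beta t - C12 p t * alpha t
              - C13 p t * alpha t * beta t + C14 p t * beta t ^+ 2
              + C15 p t = 0]},
      alpha b = S1
    & beta b = G].

(* Main.v *)
Require Import Defs.
From HB Require Import structures.
From mathcomp Require Import all_boot all_order all_algebra.
From mathcomp Require Import all_classical all_reals all_analysis.
From mathcomp Require Import measurable_realfun.
From mathcomp Require Import ring lra.

Set Implicit Arguments.
Unset Strict Implicit.
Unset Printing Implicit Defensive.

Import Order.TTheory GRing.Theory Num.Theory.
Import numFieldNormedType.Exports.

Local Open Scope classical_set_scope.
Local Open Scope ring_scope.

(**
Uniqueness. For an absolutely continuous f whose derivative is bounded almost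
everywhere by that of a nondecreasing phi, the increment of f is bounded by that
of phi: a compactness argument on [a, b] (in the form of a real induction) cuts
the interval into pieces on which either the derivatives control the increments,
or which lie in an open set of small measure containing all exceptional points,
where absolute continuity applies. Applied to the difference of two solutions
with phi an exponential weight, this shows that their weighted distance is at
most half of itself.

Existence. The coefficients agree almost everywhere with bounded Borel functions.
For the latter, Picard iteration in a ball of radius 1 around the terminal value
converges uniformly on a short interval, and the limit is a Lipschitz function
which by Lebesgue's differentiation theorem satisfies the equations almost
everywhere.
*)

(** * Absolutely continuous functions *)

(** The step hypothesis at the supremum of the points satisfying [Q] carries [Q] from a nearby point
    on the left to points on the right, so this supremum cannot lie short of [b]. *)
Lemma real_induction (R : realType) (a b : R) (Q : R -> Prop) : a <= b -> Q a ->
  (forall c, a <= c <= b -> exists2 r : R, 0 < r &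
    forall u v, a <= u <= c -> c <= v <= b -> c - r < u -> v < c + r ->
      Q u -> Q v) ->
  Q b.
Proof.
move=> ab Qa step; pose S := [set c | a <= c <= b /\ Q c].
have supS : has_sup S.
  split; first by exists a; split; rewrite ?lexx.
  by exists b => c [/andP[]].
have Sa : S a by split; rewrite ?lexx.
have aS : a <= sup S <= b.
  rewrite (sup_upper_bound supS)//= ge_sup//; first by exists a.
  by move=> c [/andP[]].
have [r r0 {}step] := step _ aS.
have [u [/andP[au ub] Qu] ru] := sup_adherent r0 supS.
have uS : u <= sup S by apply: (sup_upper_bound supS); rewrite /S/= au.
have {Qu}Qv v : sup S <= v <= b -> v < sup S + r -> Q v.
  by move=> Sv vr; apply: step Qu => //; rewrite au.
(* If [b] is out of reach of this step, [sup S + r / 2] would be an element of [S] above its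
   supremum. *)
have [bS|bS] := ltP b (sup S + r).
  by apply: Qv => //; rewrite lexx andbT; case/andP : aS.
have Sv : S (sup S + r / 2).
  split; last by apply: Qv; lra.
  by lra.
by have := sup_upper_bound supS Sv; lra.
Qed.

Lemma derivable_linear_bound (R : realType) (f : R -> R) (t e : R) :
  derivable f t 1 -> 0 < e -> exists2 r : R, 0 < r &
    forall y, `|y - t| < r -> `|f y - f t - 'D_1 f t * (y - t)| <= e * `|y - t|.
Proof.
move=> /cvgrPdist_le/(_ e) /[apply] -[r/= r0 H].
exists r => // y yr; have [->|ynt] := eqVneq y t.
  by rewrite !subrr mulr0 subrr normr0 mulr0.
have yt0 : y - t != 0 by rewrite subr_eq0.
have := H (y - t); rewrite /ball/= sub0r normrN => /(_ yr yt0).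
rewrite [(_ - _) *: _]mulr1 subrK -[_ *: _]/(_ * _) => {}H.
have -> : f y - f t - 'D_1 f t * (y - t) =
    - ('D_1 f t - (y - t)^-1 * (f y - f t)) * (y - t).
  by field.
by rewrite normrM normrN ler_wpM2r.
Qed.

Lemma lipschitz_abs_continuous (R : realType) (a b M : R) (f : R -> R) :
  0 <= M -> (forall u v, `|f u - f v| <= M * `|u - v|) -> abs_continuous a b f.
Proof.
move=> M0 lipf e e0; have M1 : 0 < M + 1 by lra.
exists (e / (M + 1)); first exact: divr_gt0.
move=> n u v uv _ suv.
have uv0 : 0 <= \sum_(i < n) (v i - u i).
  by apply: sumr_ge0 => i _; case/andP: (uv i).1 => _; rewrite subr_ge0.
apply: (@le_lt_trans _ _ (M * \sum_(i < n) (v i - u i))).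
  rewrite mulr_sumr; apply: ler_sum => i _; rewrite (le_trans (lipf _ _))//.
  by rewrite ger0_norm// subr_ge0; case/andP: (uv i).1.
apply: (@le_lt_trans _ _ ((M + 1) * \sum_(i < n) (v i - u i))).
  by rewrite ler_wpM2r// lerDl.
by rewrite mulrC -ltr_pdivlMr.
Qed.

Lemma abs_continuous_le (R : realType) (a b a' b' : R) (f : R -> R) :
  a <= a' -> b' <= b -> abs_continuous a b f -> abs_continuous a' b' f.
Proof.
move=> aa bb acf e /acf[d d0 H]; exists d => // n u v uv; apply: H => i.
by have [/andP[? ?] ?] := uv i; rewrite (le_trans aa)//=; split=> //; exact: le_trans bb.
Qed.

Lemma abs_continuousB (R : realType) (a b : R) (f g : R -> R) :
  abs_continuous a b f -> abs_continuous a b g ->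
  abs_continuous a b (fun t => f t - g t).
Proof.
move=> acf acg e e0; have e2 : 0 < e / 2 by lra.
have [d d0 H] := acf _ e2; have [d' d'0 H'] := acg _ e2.
exists (Num.min d d'); first by rewrite lt_min d0.
move=> n u v uv tI; rewrite lt_min => /andP[sd sd'].
rewrite [ltRHS](splitr e); apply: le_lt_trans (ltrD (H _ _ _ uv tI sd) (H' _ _ _ uv tI sd')).
rewrite -big_split/=; apply: ler_sum => i _.
have -> : f (v i) - g (v i) - (f (u i) - g (u i)) =
  (f (v i) - f (u i)) - (g (v i) - g (u i)) by ring.
exact: ler_normB.
Qed.

(** Absolute continuity with tolerance 1, applied to a single interval, bounds the change of [f]
    over steps shorter than [d]. Real induction replaces the count of such steps. *)
Lemma abs_continuous_bounded (R : realType) (a b : R) (f : R -> R) : a <= b ->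
  abs_continuous a b f -> exists K, forall t, a <= t <= b -> `|f t| <= K.
Proof.
move=> ab /(_ 1 ltr01)[d d0 H].
have close u v : a <= u -> u <= v -> v <= b -> v - u < d -> `|f v - f u| < 1.
  move=> au uv vb vud.
  have := H 1 (fun=> u) (fun=> v); rewrite !big_ord1; apply => //.
    by move=> _; rewrite au uv.
  by move=> i j _ _ _; rewrite !ord1.
pose Q c := exists K, forall t, a <= t <= c -> `|f t| <= K.
apply: (@real_induction _ a b Q) => //.
  by exists `|f a| => t at_; have -> : t = a by lra.
move=> c /andP[ac cb]; exists (d / 2); first by lra.
move=> u v /andP[au uc] /andP[cv vb] ru vr [K HK].
exists (K + 1) => t /andP[at_ tv].
have [tu|ut] := leP t u.
  by rewrite (le_trans (HK t _)) ?at_ ?lerDl.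
have := close u t au (ltW ut) (le_trans tv vb).
have /HK : a <= u <= u by rewrite au lexx.
have := ler_distD (f u) (f t) 0; rewrite !subr0 => h1 h2 h3.
have /h3 : t - u < d by lra.
lra.
Qed.

(** * Null sets and the comparison of increments *)

Lemma negligible_open_cover (R : realType) (N : set R) (d : R) :
  (@lebesgue_measure R).-negligible N -> 0 < d ->
  exists U : set R, [/\ open U, N `<=` U & (lebesgue_measure U < d%:E)%E].
Proof.
move=> [A [mA A0 NA]] d0.
have [U [oU AU UA]] : exists U : set R,
    [/\ open U, A `<=` U & (lebesgue_measure (U `\` A) < d%:E)%E].
  apply: lebesgue_regularity_outer => //.
  by have := A0; rewrite /= => ->.
exists U; split=> //; first exact: subset_trans AU.
have -> : lebesgue_measure U =
    (lebesgue_measure (U `\` A) + lebesgue_measure (U `&` A))%E.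
  by apply: measureDI => //; exact: open_measurable.
by rewrite setIidr// [X in (_ + X)%E](_ : _ = 0%E) ?adde0.
Qed.

Lemma sum_length_le_measure (R : realType) (U : set R) n (u v : 'I_n -> R) :
  measurable U -> (forall i, u i <= v i /\ `]u i, v i[%classic `<=` U) ->
  trivIset setT (fun i => [set` `]u i, v i[]) ->
  ((\sum_(i < n) (v i - u i))%:E <= lebesgue_measure U)%E.
Proof.
move=> mU uvU tI.
have mV : measurable (\big[setU/set0]_(i < n) [set` `]u i, v i[]).
  by apply: bigsetU_measurable => i _; exact: measurable_itv.
apply: (@le_trans _ _
    (lebesgue_measure (\big[setU/set0]_(i < n) [set` `]u i, v i[]))); last first.
  rewrite le_measure ?inE//.
  elim/big_ind : _ => [|X Y XU YU t [/XU|/YU]//|i _]; first exact: sub0set.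
  exact: (uvU i).2.
rewrite measure_semi_additive_ord//.
rewrite -sumEFin; apply: lee_sum => i _.
have := lebesgue_measure_itv `]u i, v i[; rewrite /= => ->; rewrite lte_fin.
by case: ltP => [//|vu]; rewrite lee_fin subr_le0.
Qed.

(** The order runs from right to left because the real induction below adds each new interval at the
    head of the list. *)
Lemma trivIset_pairwise_itv (R : realType) (s : seq (R * R)) :
  pairwise (fun p q => q.2 <= p.1) s ->
  trivIset setT (fun i : 'I_(size s) =>
    [set` `](nth (0, 0) s i).1, (nth (0, 0) s i).2[]).
Proof.
move=> /(pairwiseP (0, 0)) sP; apply/trivIsetP => /=.
have key (i j : 'I_(size s)) : (i < j)%N ->
    `](nth (0, 0) s i).1, (nth (0, 0) s i).2[%classic `&`
    `](nth (0, 0) s j).1, (nth (0, 0) s j).2[%classic = set0.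
  move=> ij; rewrite -subset0 => t [/=]; rewrite !in_itv/= => /andP[it _] /andP[_ tj].
  have := sP i j; rewrite !inE => /(_ (ltn_ord i) (ltn_ord j) ij) ji.
  by have := lt_trans it (lt_le_trans tj ji); rewrite ltxx.
move=> i j _ _; case: (ltngtP i j) => [/key//| |/val_inj->]; last by rewrite eqxx.
by rewrite setIC => /key.
Qed.

Lemma abs_continuous_increment_le (R : realType) (a b : R) (f phi : R -> R) :
  a <= b -> abs_continuous a b f ->
  {in `[a, b] &, {homo phi : x y / x <= y}} ->
  {ae (@lebesgue_measure R), forall t : R, t \in `]a, b[ ->
    [/\ derivable f t 1, derivable phi t 1 & 'D_1 f t <= 'D_1 phi t]} ->
  f b - f a <= phi b - phi a.
Proof.
move=> ab acf mono fphi; apply/ler_addgt0Pr => e0 e0_gt0.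
(* The term [e * (b - a)] pays for the linear approximations at good points, and the last [e] for
   the intervals covering the exceptional set. *)
have [e e_gt0 ebae0] : exists2 e, 0 < e & e * (b - a) + e <= e0.
  exists (e0 / (b - a + 1)); first by rewrite divr_gt0//; lra.
  have -> : e0 / (b - a + 1) * (b - a) + e0 / (b - a + 1) =
      e0 / (b - a + 1) * (b - a + 1) by ring.
  rewrite divfK//; apply: lt0r_neq0; lra.
have [d d0 acd] := acf _ e_gt0.
(* The endpoints join the exceptional set, so that every point outside its open cover is interior
   and has the derivatives. *)
have negN : (@lebesgue_measure R).-negligible ([set a] `|` [set b] `|`
   ~` [set t | t \in `]a, b[ ->
    [/\ derivable f t 1, derivable phi t 1 & 'D_1 f t <= 'D_1 phi t]]).
  apply: negligibleU => //; apply: negligibleU; apply/negligibleP => //;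
  exact: lebesgue_measure_set1.
have [U [oU NU Ud]] := negligible_open_cover negN d0.
(* The list [s] records the disjoint intervals inside [U] on which the increment of [f] is not yet
   estimated. Their total length stays below [d], so absolute continuity bounds all these increments
   at once at the end. *)
pose Q c := exists s : seq (R * R),
  [/\ all (fun p => (a <= p.1 <= p.2) && (p.2 <= c)) s,
      (forall p, p \in s -> `]p.1, p.2[%classic `<=` U),
      pairwise (fun p q => q.2 <= p.1) s &
      f c - f a <= phi c - phi a + e * (c - a) +
        \sum_(p <- s) `|f p.2 - f p.1|].
suff [s [sab sU sp fs]] : Q b.
  apply: (le_trans fs); rewrite -addrA lerD2l (le_trans _ ebae0)// lerD2l ltW//.
  rewrite (big_nth (0, 0)) big_mkord.
  have sP i : (i < size s)%N -> nth (0, 0) s i \in s by exact: mem_nth.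
  apply: (acd _ (fun i => (nth (0, 0) s i).1) (fun i => (nth (0, 0) s i).2)).
  - move=> i; have /allP/(_ _ (sP i (ltn_ord i)))/andP[] := sab => -> ?.
    by split.
  - exact: trivIset_pairwise_itv.
  - rewrite -lte_fin (le_lt_trans _ Ud)//.
    apply: (sum_length_le_measure (open_measurable oU)); last first.
      exact: trivIset_pairwise_itv.
    move=> i; split; last exact/sU/sP.
    by have /allP/(_ _ (sP i (ltn_ord i)))/andP[/andP[]] := sab.
apply: (@real_induction _ a b Q) => //.
  by exists [::]; split => //; rewrite big_nil !subrr mulr0 !addr0.
(* Around a point of [U] the interval is put on the list, and monotonicity of [phi] keeps the rest
   of the estimate valid. *)
move=> c cab; have [Uc|Uc] := pselect (U c).
  have /nbhs_ballP[r/= r0 rU] : nbhs c U by exact: open_nbhs_nbhs.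
  exists r => // u v /andP[au uc] /andP[cv vb] ru vr [s [sab sU sp fs]].
  exists ((u, v) :: s); split => /=.
  - rewrite au (le_trans uc cv) lexx/=; apply: sub_all sab => p /andP[-> pu].
    by rewrite (le_trans pu)// (le_trans uc).
  - move=> p; rewrite inE => /predU1P[->|/sU//] t /=.
    rewrite in_itv/= => /andP[ut tv]; apply: rU.
    by rewrite /ball/= ltr_norml; lra.
  - by rewrite sp andbT; apply: sub_all sab => p /andP[_].
  - rewrite big_cons/=.
    have : phi u <= phi v.
      by apply: mono; rewrite ?in_itv/=; lra.
    have : 0 <= e * (v - u) by apply: mulr_ge0; lra.
    by have := ler_norm (f v - f u); lra.
have [cab' [df dphi dle]] : (c \in `]a, b[) /\
    [/\ derivable f c 1, derivable phi c 1 & 'D_1 f c <= 'D_1 phi c].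
  have cab' : c \in `]a, b[.
    have [ca cb] : c != a /\ c != b.
      by split; apply/eqP => cE; apply: Uc; apply: NU; left; [left|right].
    by rewrite in_itv/= !lt_neqAle eq_sym ca cb.
  split=> //; apply: contrapT => H; apply: Uc; apply: NU; right => /=.
  by move=> /(_ cab').
(* At a good point the linear errors of [f] and [phi] each cost half of [e * (v - u)]. *)
have e2 : 0 < e / 2 by lra.
have [r r0 Hf] := derivable_linear_bound df e2.
have [r' r'0 Hphi] := derivable_linear_bound dphi e2.
exists (Num.min r r'); first by rewrite lt_min r0.
move=> u v /andP[au uc] /andP[cv vb].
rewrite ltrBlDr -ltrBlDl => ru; rewrite -ltrBlDl => rv.
have uE : `|u - c| = c - u by rewrite distrC ger0_norm// subr_ge0.
have vE : `|v - c| = v - c by rewrite ger0_norm// subr_ge0.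
move: ru rv; rewrite -uE -vE !lt_min => /andP[/Hf + /Hphi +] /andP[/Hf + /Hphi +].
rewrite uE vE !ler_norml.
move=> fu phiu fv phiv [s [sab sU sp fs]]; exists s; split => //.
  by apply: sub_all sab => p /andP[-> pu]; rewrite (le_trans pu)// (le_trans uc).
have : 0 <= ('D_1 phi c - 'D_1 f c) * (v - u).
  by rewrite mulr_ge0//; lra.
lra.
Qed.
(** * Uniqueness of Caratheodory solutions *)

(** A positive [x] would contradict the Archimedean property, since [2 ^+ n] eventually exceeds
    [C / x]. *)
Lemma le0_of_le_geometric (R : realType) (x C : R) :
  (forall n, x <= C * 2^-1 ^+ n) -> x <= 0.
Proof.
move=> xC; rewrite leNgt; apply/negP => x0.
have C0 : 0 <= C by have := xC 0%N; rewrite expr0 mulr1 => /(le_trans (ltW x0)).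
have Cx : 0 <= C / x by rewrite divr_ge0// ltW.
have := archi_boundP Cx; set n := Num.bound _ => Cn.
have : C / x < 2 ^+ n.
  by apply: lt_le_trans Cn _; rewrite -natrX ler_nat ltnW// ltn_expl.
rewrite ltr_pdivrMr// => {}Cn.
have := xC n; rewrite exprVn ler_pdivlMr ?exprn_gt0// mulrC.
by rewrite leNgt Cn.
Qed.

(** For nonnegative [k] and [l] this function is nondecreasing, and its derivative is a multiple of
    the weight. It serves as the comparison function [phi] for increments. *)
Lemma is_derive_exp_weight (R : realType) (k l b t : R) :
  is_derive t 1 (fun s => - (k * expR (l * (b - s)))) (k * l * expR (l * (b - t))).
Proof.
have h : is_derive t (1 : R) (fun s : R => l * (b - s)) (- l).
  apply: is_derive_eq; rewrite /GRing.scale/=; ring.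
have he : is_derive t (1 : R) (fun s => expR (l * (b - s))) (expR (l * (b - t)) * - l).
  exact: (is_derive1_comp (f := @expR R)).
have hk : is_derive t (1 : R) (fun s => k * expR (l * (b - s)))
    (k * (expR (l * (b - t)) * - l)).
  exact: (is_deriveZ k).
apply: is_derive_eq; ring.
Qed.

(* The Lipschitz condition for the sup norm on I -> R is expressed through the
   upper bounds d of the distance, so that I may be infinite. *)
Lemma caratheodory_unique (R : realType) (I : Type) (a b L K : R)
    (F : I -> R -> (I -> R) -> R) (x y : I -> R -> R) :
  0 <= L ->
  (forall i, abs_continuous a b (x i)) ->
  (forall i, abs_continuous a b (y i)) ->
  (forall i t, a <= t <= b -> `|x i t - y i t| <= K) ->
  (forall i, x i b = y i b) ->
  (forall i t d, a <= t <= b -> (forall j, `|x j t - y j t| <= d) ->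
    `|F i t (x ^~ t) - F i t (y ^~ t)| <= L * d) ->
  (forall i, {ae (@lebesgue_measure R), forall t : R, t \in `]a, b[ ->
    is_derive t 1 (x i) (F i t (x ^~ t))}) ->
  (forall i, {ae (@lebesgue_measure R), forall t : R, t \in `]a, b[ ->
    is_derive t 1 (y i) (F i t (y ^~ t))}) ->
  forall i t, a <= t <= b -> x i t = y i t.
Proof.
move=> L0 acx acy xyK xyb lipF dx dy i t tab.
have K0 : 0 <= K by exact: le_trans (xyK i t tab).
(* The choice gives [L * m <= m / 2 * l], which produces the factor 1/2. The summand 1 keeps [l]
   positive when [L] is zero. *)
pose l := 2 * L + 1; have l0 : 0 < l by rewrite /l; lra.
pose w s := expR (l * (b - s)).
have w1 s : s <= b -> 1 <= w s.
  by move=> sb; rewrite -expR0 ler_expR mulr_ge0 ?(ltW l0)// subr_ge0.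
(* The weight makes the Picard operator a contraction by 1/2 on all of [a, b]. *)
have bound n j s : a <= s <= b -> `|x j s - y j s| <= K * 2^-1 ^+ n * w s.
  elim: n j s => [|n IH] j s sab.
    rewrite expr0 mulr1 (le_trans (xyK j s sab))// ler_peMr// w1//.
    by case/andP : sab.
  set m := K * 2^-1 ^+ n in IH.
  have m0 : 0 <= m by rewrite mulr_ge0// exprn_ge0.
  have -> : K * 2^-1 ^+ n.+1 * w s = m / 2 * w s by rewrite exprSr mulrA.
  have {sab}[as_ sb] : a <= s /\ s <= b by apply/andP.
  pose phi u := - (m / 2 * w u).
  have mono : {in `[s, b] &, {homo phi : u v / u <= v}}.
    move=> u v _ _ uv; rewrite lerN2 ler_wpM2l ?divr_ge0// ler_expR.
    by rewrite ler_wpM2l ?(ltW l0)// lerD2l lerN2.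
  (* A one-sided estimate for arbitrary [f] and [g]: exchanging [x] and [y] in it yields the bound
     on the absolute value. *)
  have key (f g : I -> R -> R) : (forall i, abs_continuous a b (f i)) ->
      (forall i, abs_continuous a b (g i)) ->
      (forall t, a < t < b -> `|F j t (f ^~ t) - F j t (g ^~ t)| <= L * (m * w t)) ->
      {ae (@lebesgue_measure R), forall t : R, t \in `]a, b[ ->
        is_derive t 1 (f j) (F j t (f ^~ t))} ->
      {ae (@lebesgue_measure R), forall t : R, t \in `]a, b[ ->
        is_derive t 1 (g j) (F j t (g ^~ t))} ->
      (f j b - g j b) - (f j s - g j s) <= phi b - phi s.
    move=> acf acg Ffg df dg.
    apply: (@abs_continuous_increment_le _ s b (fun u => f j u - g j u)) => //.
      by apply: abs_continuousB; exact: abs_continuous_le as_ (lexx b) _.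
    apply: (@filterS2 _ _ (ae_filter_ringOfSetsType (@lebesgue_measure R))
      _ _ _ _ df dg) => u + + usb.
    have uab : u \in `]a, b[.
      by move: usb; rewrite !in_itv/= => /andP[su ->]; rewrite (le_lt_trans as_).
    move=> /(_ uab) dfu /(_ uab) dgu.
    have dphi := is_derive_exp_weight (m / 2) l b u.
    have dfg : is_derive u 1 (fun u => f j u - g j u)
      (F j u (f ^~ u) - F j u (g ^~ u)) := is_deriveB dfu dgu.
    split; [by case: dfg|by case: dphi|].
    have [_ ->] := dfg; have [_ ->] := dphi.
    apply: le_trans (ler_norm _) _.
    have := Ffg u; rewrite in_itv/= in uab => /(_ uab)/le_trans; apply.
    rewrite -/(w u) mulrA ler_wpM2r ?expR_ge0//.
    by rewrite /l; have := mulr_ge0 L0 m0; lra.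
  have Fxy u : a < u < b -> `|F j u (x ^~ u) - F j u (y ^~ u)| <= L * (m * w u).
    by move=> /andP[/ltW au /ltW ub]; apply: lipF => [|k]; [|apply: IH]; rewrite au.
  have h1 := key x y acx acy Fxy (dx j) (dy j).
  have Fyx u : a < u < b -> `|F j u (y ^~ u) - F j u (x ^~ u)| <= L * (m * w u).
    by rewrite distrC; exact: Fxy.
  have h2 := key y x acy acx Fyx (dy j) (dx j).
  move: h1 h2; rewrite xyb /phi; have -> : w b = 1.
    by rewrite /w subrr mulr0 expR0.
  by move=> h1 h2; rewrite ler_norml; lra.
apply/eqP; rewrite -subr_eq0 -normr_le0.
apply: (@le0_of_le_geometric _ _ (K * w t)) => n.
by rewrite mulrAC; exact: bound.
Qed.
(** * Borel versions of Lebesgue measurable functions *)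

(** The Caratheodory sigma-algebra is the completion of the Borel one. *)
Lemma lebesgue_measurable_borelU (R : realType) (E : set R) :
  @measurable _ (caratheodory_type (wlength (@idfun R))^*%mu) E ->
  exists BN : set R * set R,
    [/\ measurable BN.1, (@lebesgue_measure R).-negligible BN.2 &
        E = BN.1 `|` BN.2].
Proof.
have := @completed_caratheodory_measurable R.
rewrite g_sigma_completed_algebra_genE => h mE.
have : measurable_realfun.completed_algebra_gen (@lebesgue_measure R) E.
  by rewrite h.
by move=> [B mB [N negN BNE]]; exists (B, N).
Qed.

(* Off a Borel null set containing the null parts of all the sets [f > q], q
   rational, f is Borel measurable. *)
Lemma borel_version (R : realType) (D : set R) (f : R -> R) :
  measurable D -> lebesgue_measurable_fun D f ->
  exists g : R -> R, [/\ measurable_fun [set: measurableTypeR R] (g : measurableTypeR R -> measurableTypeR R),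
    {ae (@lebesgue_measure R), forall t, D t -> g t = f t} &
    forall t, g t = 0 \/ D t /\ g t = f t].
Proof.
move=> mD mf.
have mDc : @measurable _ (caratheodory_type (wlength (@idfun R))^*%mu) D.
  exact: sub_caratheodory.
have /choice[BN BNP] (q : rat) : exists BN : set R * set R,
    [/\ measurable BN.1, (@lebesgue_measure R).-negligible BN.2 &
        D `&` f @^-1` `]ratr q, +oo[%classic = BN.1 `|` BN.2].
  apply: lebesgue_measurable_borelU; apply: mf => //.
(* The rationals are enumerated through [unpickle], so the countable union of the null parts lies in
   one Borel null set. *)
have [M [mM M0 NM]] : (@lebesgue_measure R).-negligible
    (\bigcup_k (if (unpickle k : option rat) is Some q then (BN q).2 else set0)).
  apply: negligible_bigcup => k; case: unpickle => [q|]; last exact: negligible_set0.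
  by have [] := BNP q.
have {}NM q : (BN q).2 `<=` M.
  by move=> t Nt; apply: NM; exists (pickle q); rewrite ?pickleK.
have BM q : (D `&` f @^-1` `]ratr q, +oo[%classic) `\` M = (BN q).1 `\` M.
  have [_ _ ->] := BNP q; rewrite setDUl [X in _ `|` X](_ : _ = set0) ?setU0//.
  by rewrite setD_eq0; exact: NM.
have mfDM : measurable_fun (D `\` M : set (measurableTypeR R)) (f : measurableTypeR R -> measurableTypeR R).
  apply: (measurability _ (RGenOInfty.measurableE R)) => _ [_ [x ->] <-].
  (* By density of the rationals, the set where [f] exceeds [x] is the union of those where it
     exceeds a rational [q] above [x]. *)
  rewrite (_ : _ `&` _ = \bigcup_(q in [set q : rat | x < ratr q]) ((BN q).1 `\` M)).
    rewrite bigcup_mkcond; apply: bigcupT_measurable_rat => q.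
    by case: ifPn => // _; apply: measurableD => //; have [] := BNP q.
  apply/seteqP; split=> t /=.
    rewrite in_itv/= andbT => -[[Dt Mt] /rat_in_itvoo[q]].
    rewrite in_itv/= => /andP[xq qf]; exists q => //.
    by rewrite -BM; split=> //; split=> //=; rewrite in_itv/= qf.
  move=> [q xq]; rewrite -BM => -[[Dt] /=]; rewrite !in_itv/= !andbT => qf Mt.
  by split=> //; exact: lt_trans qf.
(* Extension by 0 preserves every nonnegative bound on [f], now on the whole line. *)
exists (f \_ (D `\` M)); split.
- by apply/(measurable_restrictT _ _).1 => //; exact: measurableD.
- exists M; split => // t /=; apply: contra_notP => Mt Dt.
  by rewrite patchE mem_set.
- move=> t; rewrite patchE; case: ifPn => [|_]; last by left.
  by rewrite inE => -[Dt _]; right.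
Qed.

(** * Algebra of bounded Lebesgue measurable functions *)

Definition lebesgue_bounded (R : realType) (D : set R) (f : R -> R) :=
  lebesgue_measurable_fun D f /\ exists M, forall t, D t -> `|f t| <= M.

Lemma lebesgue_bounded_measurable (R : realType) (D : set R) (f : R -> R) :
  bounded_measurable D f -> lebesgue_bounded D f.
Proof.
move=> [mf bf]; split=> //.
have [M [_ HM]] := bf.
(* The [bounded] notation provides bounds only strictly above its threshold [M]. *)
by exists (M + 1) => t Dt; apply: HM Dt; rewrite ltrDl.
Qed.

Lemma lebesgue_boundedM (R : realType) (D : set R) (f g : R -> R) :
  lebesgue_bounded D f -> lebesgue_bounded D g ->
  lebesgue_bounded D (fun t => f t * g t).
Proof.
move=> [mf [M fM]] [mg [N gN]]; split.
  exact: measurable_funM.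
by exists (M * N) => t Dt; rewrite normrM ler_pM// ?fM ?gN.
Qed.

Lemma lebesgue_boundedD (R : realType) (D : set R) (f g : R -> R) :
  lebesgue_bounded D f -> lebesgue_bounded D g ->
  lebesgue_bounded D (fun t => f t + g t).
Proof.
move=> [mf [M fM]] [mg [N gN]]; split.
  exact: measurable_funD.
by exists (M + N) => t Dt; rewrite (le_trans (ler_normD _ _))// lerD ?fM ?gN.
Qed.

Lemma lebesgue_boundedB (R : realType) (D : set R) (f g : R -> R) :
  lebesgue_bounded D f -> lebesgue_bounded D g ->
  lebesgue_bounded D (fun t => f t - g t).
Proof.
move=> [mf [M fM]] [mg [N gN]]; split.
  exact: measurable_funB.
by exists (M + N) => t Dt; rewrite (le_trans (ler_normB _ _))// lerD ?fM ?gN.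
Qed.

Lemma lebesgue_bounded_cst (R : realType) (D : set R) (k : R) :
  lebesgue_bounded D (fun=> k).
Proof. by split; [exact: measurable_cst|exists `|k|]. Qed.

Lemma lebesgue_boundedV (R : realType) (D : set R) (f : R -> R) (d : R) :
  0 < d -> (forall t, D t -> d <= f t) -> lebesgue_bounded D f ->
  lebesgue_bounded D (fun t => (f t)^-1).
Proof.
move=> d0 df [mf _]; split; last first.
  exists d^-1 => t /df dft; have ft0 := lt_le_trans d0 dft.
  by rewrite ger0_norm ?invr_ge0 ?(ltW ft0)// lef_pV2.
move=> mD; apply: (measurability _ (RGenOInfty.measurableE R)) => //.
move=> _ [_ [x ->] <-].
(* The inverse is positive, so it exceeds [x] on all of [D] when [x <= 0]. For [x > 0] the condition
   becomes [f t < x^-1]. *)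
have [x0|x0] := leP x 0.
  rewrite (_ : _ `&` _ = D)//; apply/seteqP; split=> [t []//|t Dt]; split=> //=.
  by rewrite in_itv/= andbT (le_lt_trans x0)// invr_gt0 (lt_le_trans d0)// df.
rewrite (_ : _ `&` _ = D `&` f @^-1` `]-oo, x^-1[%classic); last first.
  apply/seteqP; split=> t [Dt] /=; rewrite !in_itv/= ?andbT => h; split=> //;
    have ft0 := lt_le_trans d0 (df _ Dt); rewrite /= ?in_itv/= ?andbT.
  - by rewrite -[f t]invrK ltf_pV2 ?posrE ?invr_gt0.
  - by rewrite -[x]invrK ltf_pV2 ?posrE ?invr_gt0.
by apply: mf => //; exact: measurable_itv.
Qed.
(** * Existence of Caratheodory solutions *)

Local Notation mu := lebesgue_measure.

Lemma bounded_integrable_itv (R : realType) (h : measurableTypeR R -> measurableTypeR R)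
    (M : R) (i : interval R) :
  measurable_fun setT h ->
  (mu [set` i] < +oo)%E -> (forall t, `|h t : R| <= M) ->
  mu.-integrable [set` i] (EFin \o h).
Proof.
move=> mh ioo hM; apply: measurable_bounded_integrable => //.
  exact: measurable_funTS.
by exists M; split; [exact: num_real|move=> y My t _; exact: le_trans (ltW My)].
Qed.

Lemma lebesgue_measure_itv_lty (R : realType) (b0 b1 : bool) (a b : R) :
  (mu [set` Interval (BSide b0 a) (BSide b1 b)] < +oo)%E.
Proof.
have := lebesgue_measure_itv (Interval (BSide b0 a) (BSide b1 b)).
by rewrite /= => ->; case: ifP => _; rewrite ltry.
Qed.

Lemma le_norm_Rintegral_itv (R : realType) (h : measurableTypeR R -> measurableTypeR R)
    (M : R) (b0 b1 : bool) (a b : R) : a <= b ->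
  measurable_fun setT h -> (forall t, `|h t : R| <= M) ->
  `|\int[mu]_(s in [set` Interval (BSide b0 a) (BSide b1 b)]) h s| <= M * (b - a).
Proof.
move=> ab mh hM; pose A := [set` Interval (BSide b0 a) (BSide b1 b)].
have mA : measurable (A : set (measurableTypeR R)) by exact: measurable_itv.
have ih : mu.-integrable A (EFin \o h).
  by apply: bounded_integrable_itv hM => //; exact: lebesgue_measure_itv_lty.
rewrite (le_trans (le_normr_Rintegral mA ih))//.
apply: (@le_trans _ _ (\int[mu]_(s in A) M)).
  apply: le_Rintegral => //.
    exact: integrable_norm.
  apply: (@bounded_integrable_itv _ (cst M) `|M|) => //.
  exact: lebesgue_measure_itv_lty.
rewrite Rintegral_cst//.
have := lebesgue_measure_itv (Interval (BSide b0 a) (BSide b1 b)).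
rewrite /= -/A => ->; rewrite lte_fin; case: ltP => //= ba.
by rewrite mulr0 mulr_ge0// ?subr_ge0//; exact: le_trans (hM a).
Qed.

(** The bound holds on the whole line: to the left of [a] the domain of integration is empty and the
    primitive is constantly 0. *)
Lemma primitive_lipschitz (R : realType) (h : measurableTypeR R -> measurableTypeR R)
    (M a : R) : measurable_fun setT h ->
  (forall t, `|h t : R| <= M) -> forall u v,
  `|\int[mu]_(s in `[a, u]) h s - \int[mu]_(s in `[a, v]) h s| <= M * `|u - v|.
Proof.
move=> mh hM u v; wlog uv : u v / u <= v.
  by case: (leP u v) => [/[swap]/[apply]//|/ltW /[swap]/[apply]]; rewrite distrC (distrC v).
have M0 : 0 <= M by exact: le_trans (hM 0).
rewrite [in leLHS]distrC [in leRHS]distrC (ger0_norm (_ : 0 <= v - u)) ?subr_ge0//.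
have [au|ua] := leP a u.
  rewrite Rintegral_itvB ?bnd_simp//; first exact: le_norm_Rintegral_itv.
  by apply: bounded_integrable_itv hM => //; exact: lebesgue_measure_itv_lty.
rewrite (set_itv_ge (_ : ~~ (BLeft a < BRight u)%O)) ?bnd_simp -?ltNge//.
rewrite Rintegral_set0 subr0; have [av|va] := leP a v.
  rewrite (le_trans (le_norm_Rintegral_itv _ _ av mh hM))// ler_wpM2l//.
  by rewrite lerD2l lerN2 ltW.
rewrite set_itv_ge ?bnd_simp -?ltNge// Rintegral_set0 normr0.
by rewrite mulr_ge0// subr_ge0.
Qed.

(** A bounded Borel function is locally integrable, so Lebesgue's differentiation theorem applies in
    the form of [FTC1]. *)
Lemma primitive_is_derive (R : realType) (h : measurableTypeR R -> measurableTypeR R)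
    (M a : R) : measurable_fun setT h ->
  (forall t, `|h t : R| <= M) ->
  {ae mu, forall t, a < t ->
    is_derive t 1 (fun t => \int[mu]_(s in `[a, t]) h s) (h t)}.
Proof.
move=> mh hM.
have ih y : mu.-integrable `[a, y] (EFin \o h).
  by apply: bounded_integrable_itv hM => //; exact: lebesgue_measure_itv_lty.
have lh : locally_integrable [set: R] h.
  split => //; first exact: openT.
  move=> K _ cK; have mK := compact_measurable cK.
  have /integrableP[_] : mu.-integrable K (EFin \o h).
    apply: measurable_bounded_integrable => //.
    - exact: compact_finite_measure.
    - exact: measurable_funTS.
    - by exists M; split; [exact: num_real|move=> y My t _; exact: le_trans (ltW My)].
  by [].
have := FTC1 ih lh.
apply: (@filterS _ _ (ae_filter_ringOfSetsType mu)) => t + at_.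
rewrite /= lte_fin => /(_ at_)[dF FE].
by split => //; rewrite -derive1E.
Qed.

(** The radius [g n] is the sum of all steps from [n] on. The intervals of radius [g n] around [u n]
    meet pairwise, and the supremum of their left ends lies in all of them. *)
Lemma cvg_geometric_steps (R : realType) (u : nat -> R) (C : R) :
  (forall n, `|u n.+1 - u n| <= C * 2^-1 ^+ n) ->
  exists l, u @ \oo --> l /\ forall n, `|u n - l| <= 2 * C * 2^-1 ^+ n.
Proof.
move=> step; pose g n : R := 2 * C * 2^-1 ^+ n.
have gS n : g n.+1 = g n / 2 by rewrite /g exprSr mulrA.
have g0 n : 0 <= g n by have := le_trans (normr_ge0 _) (step n); rewrite /g; lra.
have tail n k : `|u (n + k)%N - u n| <= g n - g (n + k)%N.
  elim: k => [|k IH]; first by rewrite addn0 !subrr normr0.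
  have := step (n + k)%N; have := IH; rewrite addnS gS !ler_norml /g; lra.
have cross n m : u n - g n <= u m + g m.
  case: (leqP n m) => [nm|/ltnW mn].
    have := tail n (m - n)%N; rewrite subnKC// ler_norml.
    by have := g0 m; lra.
  have := tail m (n - m)%N; rewrite subnKC// ler_norml.
  by have := g0 n; lra.
pose S := range (fun n => u n - g n).
have supS : has_sup S.
  split; first by exists (u 0%N - g 0%N), 0%N.
  by exists (u 0%N + g 0%N) => _ [n _ <-].
have bnd n : `|u n - sup S| <= g n.
  have h1 : u n - g n <= sup S by apply: (sup_upper_bound supS); exists n.
  have h2 : sup S <= u n + g n.
    by apply: ge_sup; [exact: supS.1|move=> _ [m _ <-]].
  by rewrite ler_norml; lra.
exists (sup S); split=> //.
have gcvg : g @ \oo --> (0 : R).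
  rewrite -[X in _ --> X](mulr0 (2 * C)); apply: cvgMr; apply: cvg_expr.
  by rewrite gtr0_norm ?invr_gt0// invf_lt1 ?ltr1n.
apply: (@squeeze_cvgr _ _ _ _ (fun n => sup S - g n) (fun n => sup S + g n)).
- by apply: nearW => n; have := bnd n; rewrite ler_norml; lra.
- by rewrite -[X in _ --> X](subr0 (sup S)); apply: cvgB => //; exact: cvg_cst.
- by rewrite -[X in _ --> X](addr0 (sup S)); apply: cvgD => //; exact: cvg_cst.
Qed.
(** The bound on [(b - a) * M] makes the Picard operator preserve the ball of radius [r], and the
    bound on [(b - a) * L] makes it contract by 1/2. *)
Lemma caratheodory_exists (R : realType) (I : Type) (a b L M r : R)
    (F : I -> R -> (I -> R) -> R) (x0 : I -> R) :
  a <= b -> 0 <= r -> (b - a) * M <= r -> (b - a) * L <= 2^-1 ->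
  (forall x : I -> R -> R,
    (forall j, measurable_fun [set: measurableTypeR R]
       (x j : measurableTypeR R -> measurableTypeR R)) ->
    forall i, measurable_fun [set: measurableTypeR R]
       ((fun s => F i s (x ^~ s)) : measurableTypeR R -> measurableTypeR R)) ->
  (forall i s y, a <= s <= b -> (forall j, `|y j - x0 j| <= r) ->
    `|F i s y| <= M) ->
  (forall i s y z d, a <= s <= b ->
    (forall j, `|y j - x0 j| <= r) -> (forall j, `|z j - x0 j| <= r) ->
    (forall j, `|y j - z j| <= d) -> `|F i s y - F i s z| <= L * d) ->
  exists x : I -> R -> R,
    [/\ forall i, x i b = x0 i,
        forall i u v, `|x i u - x i v| <= M * `|u - v| &
        forall i, {ae (@lebesgue_measure R), forall t : R, t \in `]a, b[ ->
          is_derive t 1 (x i) (F i t (x ^~ t))}].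
Proof.
move=> ab r0 baM baL mF bF LF.
(* An index is needed to deduce [0 <= M] from the bound on [F]; without one the conclusion is
   vacuous. *)
have [i0|I0] := pselect (inhabited I); last first.
  by exists (fun _ _ => 0); split => i; exfalso; apply: I0; exists.
have M0 : 0 <= M.
  case: i0 => i; rewrite (le_trans _ (bF i a x0 _ _)) ?lexx// => j.
  by rewrite subrr normr0.
pose D : set (measurableTypeR R) := `[a, b]%classic.
have mD : measurable D by exact: measurable_itv.
(* Cutting off to 0 outside [[a, b]] makes the integrand bounded by [M] on the whole line. *)
pose h (x : I -> R -> R) i : measurableTypeR R -> measurableTypeR R :=
  (fun s => F i s (x ^~ s)) \_ D.
have hE x i s : a <= s <= b -> h x i s = F i s (x ^~ s).
  by move=> sab; rewrite /h patchE mem_set//= in_itv.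
have hN x i s : ~~ (a <= s <= b) -> h x i s = 0.
  by move=> /negP sab; rewrite /h patchE memNset// /D /= in_itv.
pose P (k : measurableTypeR R -> measurableTypeR R) t : R :=
  \int[lebesgue_measure]_(s in `[a, t]) k s.
(* Subtracting the value at [b] turns the primitive based at [a] into one with terminal value
   [x0 i]. *)
pose K (x : I -> R -> R) i t : R := x0 i + (P (h x i) t - P (h x i) b).
pose good (x : I -> R -> R) :=
  (forall j, measurable_fun [set: measurableTypeR R]
     (x j : measurableTypeR R -> measurableTypeR R)) /\
  forall j t, a <= t <= b -> `|x j t - x0 j| <= r.
have mh x i : good x -> measurable_fun setT (h x i).
  by move=> [mx _]; apply/(measurable_restrictT _ _).1 => //; exact: measurable_funTS (mF _ mx i).
have hM x i t : good x -> `|h x i t| <= M.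
  move=> [_ xr]; have [tab|tab] := boolP (a <= t <= b).
    by rewrite hE//; apply: bF => // j; exact: xr.
  by rewrite hN// normr0.
have Klip x i u v : good x -> `|K x i u - K x i v| <= M * `|u - v|.
  move=> gx; rewrite (_ : _ - _ = P (h x i) u - P (h x i) v); last by rewrite /K; ring.
  by apply: primitive_lipschitz => [|t]; [exact: mh|exact: hM].
have Kb x i : K x i b = x0 i by rewrite /K subrr addr0.
have goodK x : good x -> good (K x).
  move=> gx; split=> [j|j t /andP[at_ tb]].
    apply: continuous_measurable_fun => u; apply/cvgrPdist_le => e e0.
    have M1 : 0 < M + 1 by lra.
    apply/nbhs_ballP; exists (e / (M + 1)) => /=; first exact: divr_gt0.
    move=> v /ltW uv; rewrite (le_trans (Klip _ _ _ _ gx))//.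
    apply: (@le_trans _ _ ((M + 1) * `|u - v|)).
      by rewrite ler_wpM2r// lerDl.
    by rewrite mulrC -ler_pdivlMr.
  rewrite -(Kb x j) (le_trans (Klip _ _ _ _ gx))// (le_trans _ baM)// mulrC.
  by rewrite ler_wpM2r// distrC ger0_norm ?subr_ge0// lerD2l lerN2.
have PB k1 k2 m1 m2 t : measurable_fun setT k1 -> measurable_fun setT k2 ->
    (forall s, `|k1 s : R| <= m1) -> (forall s, `|k2 s : R| <= m2) ->
    P k1 t - P k2 t = P (fun s => k1 s - k2 s) t.
  move=> mk1 mk2 k1m k2m; rewrite /P RintegralB//.
    by apply: bounded_integrable_itv k1m => //; exact: lebesgue_measure_itv_lty.
  by apply: bounded_integrable_itv k2m => //; exact: lebesgue_measure_itv_lty.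
have contr x y d : good x -> good y ->
    (forall j t, a <= t <= b -> `|x j t - y j t| <= d) ->
    forall j t, a <= t <= b -> `|K x j t - K y j t| <= d / 2.
  move=> gx gy xyd j t /andP[at_ tb].
  have d0 : 0 <= d by apply: le_trans (xyd j a _); rewrite ?lexx.
  (* The sign is read off from the Lipschitz bound at [a]. *)
  have Ld0 : 0 <= L * d.
    have aab : a <= a <= b by rewrite lexx.
    by rewrite (le_trans _ (LF j a (x ^~ a) (y ^~ a) d aab _ _ _))// => i;
      [exact: gx.2|exact: gy.2|exact: xyd].
  rewrite (_ : _ - _ = (P (h x j) t - P (h y j) t) - (P (h x j) b - P (h y j) b)); last first.
    by rewrite /K; ring.
  have mhx := mh x j gx; have mhy := mh y j gy.
  have hxM s : `|h x j s : R| <= M by exact: hM.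
  have hyM s : `|h y j s : R| <= M by exact: hM.
  rewrite !(PB _ _ M M)//.
  apply: (@le_trans _ _ (L * d * `|t - b|)).
    apply: primitive_lipschitz => [|s]; first exact: measurable_funB.
    have [sab|sab] := boolP (a <= s <= b); last by rewrite !hN// subrr normr0.
    by rewrite !hE//; apply: LF => // i; [exact: gx.2|exact: gy.2|exact: xyd].
  rewrite distrC (ger0_norm (_ : 0 <= b - t)) ?subr_ge0//.
  apply: (@le_trans _ _ (L * d * (b - a))); first by rewrite ler_wpM2l// lerD2l lerN2.
  by rewrite mulrC mulrA mulrC ler_wpM2l.
pose X n := iter n K (fun i _ => x0 i).
have gX n : good (X n).
  elim: n => [|n]; last exact: goodK.
  by split=> [j|j t _]; [exact: measurable_cst|rewrite subrr normr0].
have XS n i t : a <= t <= b -> `|X n.+1 i t - X n i t| <= r * 2^-1 ^+ n.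
  elim: n i t => [|n IH] i t tab; first by rewrite expr0 mulr1; exact: (gX 1).2.
  by rewrite exprSr mulrA; exact: (contr (X n.+1) (X n) _ (gX _) (gX _)).
(* Restricting the iterates to [D] makes them converge everywhere, so the limit is Borel measurable
   on the whole line. *)
have lim (it : I * R) : exists l, (fun n => (X n it.1 \_ D) it.2) @ \oo --> l /\
    forall n, `|(X n it.1 \_ D) it.2 - l| <= 2 * r * 2^-1 ^+ n.
  apply: cvg_geometric_steps => n; rewrite !patchE.
  case: ifPn => [|_]; first by rewrite inE /D /= in_itv => tab; exact: XS.
  by rewrite subrr normr0 mulr_ge0// exprn_ge0.
have [l lP] := choice lim; pose x i t := l (i, t).
have xX n i t : a <= t <= b -> `|X n i t - x i t| <= 2 * r * 2^-1 ^+ n.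
  by move=> tab; have := (lP (i, t)).2 n; rewrite patchE mem_set//= in_itv.
have gx : good x.
  split=> [j|j t tab].
    apply: (@measurable_fun_cvg _ _ _ _ (fun n => X n j \_ D)).
      move=> n; apply/(measurable_restrictT _ _).1 => //.
      exact: measurable_funTS ((gX n).1 j).
    by move=> t _; exact: (lP (j, t)).1.
  rewrite -subr_le0; apply: (@le0_of_le_geometric _ _ (2 * r)) => n.
  have := xX n j t tab; have := (gX n).2 j t tab.
  have := ler_distD (X n j t) (x j t) (x0 j); rewrite (distrC (x j t) (X n j t)).
  lra.
have Kx i t : a <= t <= b -> K x i t = x i t.
  move=> tab; apply/eqP; rewrite -subr_eq0 -normr_le0.
  apply: (@le0_of_le_geometric _ _ (2 * r)) => n.
  have h1 := contr (X n) x _ (gX n) gx (xX n) i t tab.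
  have h2 := xX n.+1 i t tab.
  have := ler_distD (X n.+1 i t) (K x i t) (x i t).
  rewrite (distrC (K x i t) (X n.+1 i t)).
  by move: h1 h2; rewrite -[K (X n)]/(X n.+1) exprSr; lra.
(* The functions [K x] and [x] agree on [[a, b]], but [K x] is moreover Lipschitz on the whole
   line. *)
exists (K x); split => // [i u v|i]; first exact: Klip.
have := primitive_is_derive a (mh x i gx) (fun t => hM x i t gx).
apply: (@filterS _ _ (ae_filter_ringOfSetsType (@lebesgue_measure R))) => t dP.
rewrite in_itv/= => /andP[at_ tb]; have {}dP := dP at_.
have tab : a <= t <= b by rewrite !ltW.
rewrite (_ : K x ^~ t = x ^~ t); last by apply/funext => j; exact: Kx.
rewrite -hE//.
have c1 : is_derive t (1 : R) (cst (x0 i)) 0 by exact: is_derive_cst.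
have c2 : is_derive t (1 : R) (cst (P (h x i) b)) 0 by exact: is_derive_cst.
have := is_deriveD c1 (is_deriveB dP c2).
by rewrite add0r subr0.
Qed.
(** * The Riccati system *)

(** Both equations have this form, so one bound and one Lipschitz estimate serve for the two of
    them. *)
Definition quadratic (R : realType) (c : nat -> R) (x y : R) : R :=
  c 0%N + c 1%N * x + c 2%N * y + c 3%N * (x * y) + c 4%N * (x * x)
    + c 5%N * (y * y).

Lemma quadratic_bounded (R : realType) (c : nat -> R) (B r x y : R) :
  (forall k, (k < 6)%N -> `|c k| <= B) -> `|x| <= r -> `|y| <= r ->
  `|quadratic c x y| <= B * (1 + 2 * r + 3 * (r * r)).
Proof.
move=> cB xr yr; rewrite /quadratic.
have h k z s : (k < 6)%N -> `|z| <= s -> `|c k * z| <= B * s.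
  by move=> k6 zs; rewrite normrM ler_pM// cB.
have h2 u v : `|u| <= r -> `|v| <= r -> `|u * v| <= r * r.
  by move=> ur vr; rewrite normrM ler_pM.
have -> : B * (1 + 2 * r + 3 * (r * r)) =
  B + B * r + B * r + B * (r * r) + B * (r * r) + B * (r * r) by ring.
by do 5![apply: le_trans (ler_normD _ _) _; apply: lerD; last by apply: h => //; exact: h2]; exact: cB.
Qed.

(** Each of the two linear monomials contributes [d], and each of the three quadratic ones
    [2 * (r * d)] by the product rule for differences. *)
Lemma quadratic_lipschitz (R : realType) (c : nat -> R) (B r d x y x' y' : R) :
  (forall k, (k < 6)%N -> `|c k| <= B) ->
  `|x| <= r -> `|y| <= r -> `|x'| <= r -> `|y'| <= r ->
  `|x - x'| <= d -> `|y - y'| <= d ->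
  `|quadratic c x y - quadratic c x' y'| <= B * (2 + 6 * r) * d.
Proof.
move=> cB xr yr xr' yr' xd yd.
have -> : quadratic c x y - quadratic c x' y' =
    c 1%N * (x - x') + c 2%N * (y - y') + c 3%N * (x * y - x' * y')
    + c 4%N * (x * x - x' * x') + c 5%N * (y * y - y' * y').
  by rewrite /quadratic; ring.
have h k z s : (k < 6)%N -> `|z| <= s -> `|c k * z| <= B * s.
  by move=> k6 zs; rewrite normrM ler_pM// cB.
have h2 u v u' v' : `|u| <= r -> `|v'| <= r -> `|u - u'| <= d -> `|v - v'| <= d ->
    `|u * v - u' * v'| <= 2 * (r * d).
  move=> ur vr ud vd.
  have -> : u * v - u' * v' = u * (v - v') + (u - u') * v' by ring.
  have -> : 2 * (r * d) = r * d + d * r by ring.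
  by rewrite (le_trans (ler_normD _ _))// !normrM lerD// ler_pM.
have -> : B * (2 + 6 * r) * d = B * d + B * d + B * (2 * (r * d)) +
  B * (2 * (r * d)) + B * (2 * (r * d)) by ring.
by do 4![apply: le_trans (ler_normD _ _) _; apply: lerD; last by apply: h => //; exact: h2]; exact: h.
Qed.

(* Coefficients of both equations on the monomials 1, x, y, xy, x^2, y^2 in
   x = alpha, y = beta; the boolean selects the equation (true for alpha). *)
Definition riccati_coef (R : realType) (p : riccati_data R) (i : bool) (k : nat)
    (t : R) : R :=
  match i, k with
  | true, 0%N => C6 p t
  | true, 1%N => 2 * C1 p t
  | true, 2%N => 2 * C2 p t
  | true, 3%N => 2 * C3 p t
  | true, 4%N => C4 p t
  | true, 5%N => C5 p t
  | false, 0%N => C15 p t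
  | false, 1%N => - C12 p t
  | false, 2%N => C11 p t
  | false, 3%N => - C13 p t
  | false, 5%N => C14 p t
  | _, _ => 0
  end.

(** The boolean index presents a pair as a family, as the general uniqueness and existence lemmas
    require. *)
Definition pair_fun (R : realType) (f g : R -> R) (i : bool) : R -> R :=
  if i then f else g.

Definition riccati_field (R : realType) (c : bool -> nat -> R -> R) (i : bool)
    (t : R) (z : bool -> R) : R :=
  - quadratic (fun k => c i k t) (z true) (z false).

Lemma riccati_solutionE (R : realType) (p : riccati_data R) (S1 G a b : R)
    (alpha beta : R -> R) :
  riccati_solution p S1 G a b alpha beta <->
  [/\ forall i, abs_continuous a b (pair_fun alpha beta i),
      forall i, {ae (@lebesgue_measure R), forall t : R, t \in `]a, b[ ->
        is_derive t 1 (pair_fun alpha beta i) (riccati_field (riccati_coef p) i t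
          (fun j => pair_fun alpha beta j t))} &
      forall i, pair_fun alpha beta i b = if i then S1 else G].
Proof.
split=> [[aca acb dab ab bb]|[ac dab init]].
  split; [by case|case|by case]; move: dab;
    apply: (@filterS _ _ (ae_filter_ringOfSetsType (@lebesgue_measure R))) => t H
      /H[da db Ha Hb]; split => //; rewrite /riccati_field/quadratic/pair_fun/=.
  - by move: Ha; lra.
  - by move: Hb; lra.
split; [exact: (ac true)|exact: (ac false)| |exact: (init true)|exact: (init false)].
apply: (@filterS2 _ _ (ae_filter_ringOfSetsType (@lebesgue_measure R))
  _ _ _ _ (dab true) (dab false)) => t + + tab.
move=> /(_ tab) da /(_ tab) db; split; [by case: da|by case: db| |].
- have [_ ->] := da; rewrite /riccati_field/quadratic/=; ring.
- have [_ ->] := db; rewrite /riccati_field/quadratic/=; ring.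
Qed.

(** Uniform positivity of [R44] bounds its inverse; the other operations are sums, differences and
    products. *)
Lemma riccati_coef_bounded (R : realType) (T : R) (p : riccati_data R)
  (hA1 : bounded_measurable `[0, T] (A1 p))
  (hB1 : bounded_measurable `[0, T] (B1 p))
  (hD1 : bounded_measurable `[0, T] (D1 p))
  (hA2 : bounded_measurable `[0, T] (A2 p))
  (hB2 : bounded_measurable `[0, T] (B2 p))
  (hD2 : bounded_measurable `[0, T] (D2 p))
  (hsigma : bounded_measurable `[0, T] (sigma p))
  (hR11 : bounded_measurable `[0, T] (R11 p))
  (hR12 : bounded_measurable `[0, T] (R12 p))
  (hR14 : bounded_measurable `[0, T] (R14 p))
  (hR22 : bounded_measurable `[0, T] (R22 p))
  (hR24 : bounded_measurable `[0, T] (R24 p))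
  (hR44 : bounded_measurable `[0, T] (R44 p))
  (R44_unif_pos : exists2 delta : R, 0 < delta &
     forall t : R, t \in `[0, T] -> delta <= R44 p t) i k :
  lebesgue_bounded `[0, T] (riccati_coef p i k).
Proof.
have hV : lebesgue_bounded `[0, T] (fun t => (R44 p t)^-1).
  have [d d0 dR] := R44_unif_pos.
  by apply: (lebesgue_boundedV d0); [move=> t; exact: dR|exact: lebesgue_bounded_measurable].
have hN (f : R -> R) : lebesgue_bounded `[0, T] f ->
    lebesgue_bounded `[0, T] (fun t => - f t).
  rewrite (_ : (fun t => - f t) = (fun t => 0 - f t)) => [hf|].
    by apply: lebesgue_boundedB => //; exact: lebesgue_bounded_cst.
  by apply/funext => t; rewrite sub0r.
have hX (f : R -> R) : lebesgue_bounded `[0, T] f ->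
    lebesgue_bounded `[0, T] (fun t => f t ^+ 2).
  by move=> hf; exact: (lebesgue_boundedM hf hf).
have h2 (f : R -> R) : lebesgue_bounded `[0, T] f ->
    lebesgue_bounded `[0, T] (fun t => 2 * f t).
  by move=> hf; exact: (lebesgue_boundedM (lebesgue_bounded_cst _ 2) hf).
have hS (f g h : R -> R) : bounded_measurable `[0, T] f ->
    bounded_measurable `[0, T] g -> bounded_measurable `[0, T] h ->
    lebesgue_bounded `[0, T] (fun t => f t - (R44 p t)^-1 * g t * h t).
  move=> /lebesgue_bounded_measurable hf /lebesgue_bounded_measurable hg /lebesgue_bounded_measurable hh.
  exact: (lebesgue_boundedB hf (lebesgue_boundedM (lebesgue_boundedM hV hg) hh)).
have hVX (f : R -> R) : bounded_measurable `[0, T] f ->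
    lebesgue_bounded `[0, T] (fun t => (R44 p t)^-1 * f t ^+ 2).
  by move=> /lebesgue_bounded_measurable hf; exact: (lebesgue_boundedM hV (hX _ hf)).
have hA := lebesgue_bounded_measurable hA1; have hB := lebesgue_bounded_measurable hB2.
have h1 := lebesgue_bounded_measurable hD1; have h2' := lebesgue_bounded_measurable hD2.
have h14 := lebesgue_bounded_measurable hR14; have h24 := lebesgue_bounded_measurable hR24.
case: i; (case: k => [|[|[|[|[|[|k]]]]]]); rewrite /riccati_coef.
- exact: (lebesgue_boundedB (lebesgue_bounded_measurable hR11) (hVX _ hR14)).
- exact: (h2 _ (hS _ _ _ hA1 hD1 hR14)).
- exact: (h2 _ (hS _ _ _ hR12 hR14 hR24)).
- exact: (h2 _ (hS _ _ _ hB1 hD1 hR24)).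
- exact: (lebesgue_boundedB (lebesgue_boundedM (lebesgue_bounded_cst _ (theta p))
    (hX _ (lebesgue_bounded_measurable hsigma))) (hVX _ hD1)).
- exact: (lebesgue_boundedB (lebesgue_bounded_measurable hR22) (hVX _ hR24)).
- exact: lebesgue_bounded_cst.
- exact: (hS _ _ _ hA2 hD2 hR14).
- exact: (hN _ (lebesgue_boundedM (lebesgue_boundedM hV h1) h2')).
- exact: (lebesgue_boundedB (lebesgue_boundedD hA hB) (lebesgue_boundedM hV
    (lebesgue_boundedD (lebesgue_boundedM h1 h14) (lebesgue_boundedM h2' h24)))).
- exact: (hN _ (hVX _ hD1)).
- exact: lebesgue_bounded_cst.
- exact: (hS _ _ _ hB1 hD1 hR24).
- exact: lebesgue_bounded_cst.
Qed.

(** * Local well-posedness of the Riccati system *)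

Lemma riccati_coef_bound (R : realType) (T : R) (p : riccati_data R) :
  (forall i k, lebesgue_bounded `[0, T] (riccati_coef p i k)) ->
  exists B, forall i k t, (k < 6)%N ->
  t \in `[0, T] -> `|riccati_coef p i k t| <= B.
Proof.
move=> hc.
have /choice[b bP] (ik : bool * 'I_6) : exists M, forall t, t \in `[0, T] ->
    `|riccati_coef p ik.1 ik.2 t| <= M.
  by have [_ [M HM]] := hc ik.1 ik.2; exists M.
(* The sum over the twelve pairs of indices dominates each individual bound. *)
exists (\sum_ik `|b ik|) => i k t k6 tT.
rewrite (le_trans (bP (i, Ordinal k6) t tT))// (le_trans (ler_norm _))//.
by rewrite (bigD1 (i, Ordinal k6))//= lerDl sumr_ge0.
Qed.

(** Absolutely continuous solutions are bounded, hence stay in a common ball, on which the quadratic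
    field is Lipschitz. *)
Lemma riccati_unique (R : realType) (T S1 G : R) (p : riccati_data R) (a : R)
    (al be al' be' : R -> R) :
  (forall i k, lebesgue_bounded `[0, T] (riccati_coef p i k)) ->
  0 <= a -> a <= T ->
  riccati_solution p S1 G a T al be -> riccati_solution p S1 G a T al' be' ->
  forall t, a <= t <= T -> al' t = al t /\ be' t = be t.
Proof.
move=> hc a0 aT /riccati_solutionE[ac1 d1 i1] /riccati_solutionE[ac2 d2 i2].
set x := pair_fun al be in ac1 d1 i1; set y := pair_fun al' be' in ac2 d2 i2.
have [r [xr yr]] : exists r, (forall i t, a <= t <= T -> `|x i t| <= r) /\
    (forall i t, a <= t <= T -> `|y i t| <= r).
  have [r1 H1] := abs_continuous_bounded aT (ac1 true).
  have [r2 H2] := abs_continuous_bounded aT (ac1 false).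
  have [r3 H3] := abs_continuous_bounded aT (ac2 true).
  have [r4 H4] := abs_continuous_bounded aT (ac2 false).
  exists (Num.max (Num.max r1 r2) (Num.max r3 r4)).
  by split; case=> t tab; rewrite !le_max ?(H1 _ tab) ?(H2 _ tab) ?(H3 _ tab)
    ?(H4 _ tab) ?orbT.
have [B HB] := riccati_coef_bound hc.
have B0 : 0 <= B.
  by rewrite (le_trans _ (HB true 0%N 0 _ _))// in_itv/= lexx (le_trans a0).
have r0 : 0 <= r by rewrite (le_trans _ (xr true a _))// lexx.
suff xy i t : a <= t <= T -> x i t = y i t.
  by move=> t tab; split; symmetry; [exact: (xy true)|exact: (xy false)].
apply: (@caratheodory_unique _ _ a T (B * (2 + 6 * r)) (r + r)
  (riccati_field (riccati_coef p))) => //.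
- by rewrite mulr_ge0//; lra.
- by move=> j s sab; rewrite (le_trans (ler_normB _ _))// lerD ?xr ?yr.
- by move=> j; rewrite i1 i2.
- move=> j s d sab xyd; rewrite /riccati_field -opprB opprK addrC -opprB normrN.
  rewrite [X in `|X|](_ : _ = quadratic (fun k => riccati_coef p j k s) (x true s) (x false s)
    - quadratic (fun k => riccati_coef p j k s) (y true s) (y false s)); last by ring.
  apply: quadratic_lipschitz; rewrite ?xr ?yr// => k k6; apply: HB => //.
  by rewrite in_itv/=; case/andP : sab => /(le_trans a0) ->.
Qed.

(** Picard iteration runs with Borel versions [cb] of the coefficients, since its integrands must be
    Borel. The change on a null set does not affect equations required almost everywhere. *)
Lemma riccati_exists (R : realType) (T S1 G : R) (p : riccati_data R) :
  0 < T -> (forall i k, lebesgue_bounded `[0, T] (riccati_coef p i k)) ->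
  exists2 eta : R, 0 < eta <= T &
  exists al be : R -> R, riccati_solution p S1 G (T - eta) T al be.
Proof.
move=> T_gt0 hc.
have [B HB] := riccati_coef_bound hc.
have B0 : 0 <= B.
  by rewrite (le_trans _ (HB true 0%N 0 _ _))// in_itv/= lexx ltW.
have /choice[c cP] (ik : bool * nat) : exists g : R -> R,
  [/\ measurable_fun [set: measurableTypeR R] (g : measurableTypeR R -> measurableTypeR R),
    {ae (@lebesgue_measure R), forall t, `[0, T]%classic t ->
       g t = riccati_coef p ik.1 ik.2 t} &
    forall t, g t = 0 \/ `[0, T]%classic t /\ g t = riccati_coef p ik.1 ik.2 t].
  by apply: borel_version; [exact: measurable_itv|exact: (hc _ _).1].
pose cb i k t := c (i, k) t.
(* The Borel versions vanish wherever they differ from the coefficients, so the bound [B] holds at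
   all times. *)
have cB i k t : (k < 6)%N -> `|cb i k t| <= B.
  by move=> k6; rewrite /cb; have [_ _ /(_ t)[->|[tT ->]]] := cP (i, k); [rewrite normr0|exact: HB].
pose x0 (i : bool) := if i then S1 else G.
(* This bounds both components of every point within distance 1 of the terminal value. *)
pose r := `|S1| + `|G| + 1.
have r1 : 1 <= r by have := normr_ge0 S1; have := normr_ge0 G; rewrite /r; lra.
pose M := B * (1 + 2 * r + 3 * (r * r)); pose L := B * (2 + 6 * r).
have M0 : 0 <= M.
  by apply: mulr_ge0 => //; have := mulr_ge0 (le_trans ler01 r1) (le_trans ler01 r1); lra.
have L0 : 0 <= L by apply: mulr_ge0 => //; lra.
(* The three terms keep the interval inside [[0, T]], give [e * M <= 1] and give [e * L <= 2^-1].
   Adding 1 avoids inverting zero. *)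
pose e := Num.min T (Num.min (M + 1)^-1 (2 * (L + 1))^-1).
have e0 : 0 < e by rewrite !lt_min T_gt0 !invr_gt0; lra.
have [eT eM eL] : [/\ e <= T, e * M <= 1 & e * L <= 2^-1].
  split; first by rewrite ge_min lexx.
  - apply: (@le_trans _ _ (e * (M + 1))); first by rewrite ler_wpM2l ?(ltW e0)// lerDl.
    by rewrite -ler_pdivlMr ?div1r; [rewrite !ge_min lexx orbT|lra].
  - apply: (@le_trans _ _ (e * (L + 1))); first by rewrite ler_wpM2l ?(ltW e0)// lerDl.
    rewrite -ler_pdivlMr; last lra.
    by rewrite -invfM !ge_min lexx !orbT.
have ball y i : (forall j, `|y j - x0 j| <= 1) -> `|y i| <= r.
  move=> /(_ i) yx; rewrite -(subrK (x0 i) (y i)) (le_trans (ler_normD _ _))//.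
  have : `|x0 i| <= `|S1| + `|G| by case: i {yx}; rewrite ?lerDl ?lerDr.
  by rewrite /r; lra.
exists e; first by rewrite e0.
have [x [xT xlip dx]] : exists x : bool -> R -> R,
    [/\ forall i, x i T = x0 i,
        forall i u v, `|x i u - x i v| <= M * `|u - v| &
        forall i, {ae (@lebesgue_measure R), forall t : R, t \in `]T - e, T[ ->
          is_derive t 1 (x i) (riccati_field cb i t (x ^~ t))}].
  apply: (@caratheodory_exists _ _ _ _ L M 1) => //; rewrite ?subKr//.
  - by rewrite lerBlDr lerDl ltW.
  - move=> x mx i; have mc k : measurable_fun [set: measurableTypeR R]
      (cb i k : measurableTypeR R -> measurableTypeR R) by have [] := cP (i, k).
    apply: measurableT_comp; first exact: oppr_measurable.
    by rewrite /quadratic; do ?[apply: measurable_funD | apply: measurable_funM | exact: mc | exact: mx].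
  - move=> i s y _ yx; rewrite normrN.
    by apply: quadratic_bounded => [k k6||]; [exact: cB|exact: ball|exact: ball].
  - move=> i s y z d _ yx zx yz.
    rewrite /riccati_field -opprD normrN.
    by apply: quadratic_lipschitz => [k k6||||||]; rewrite ?cB ?ball//.
exists (x true), (x false); apply/riccati_solutionE.
have xE : pair_fun (x true) (x false) = x by apply/funext => -[].
rewrite xE; split=> [i|i|i]; [|move: (dx i)|exact: xT].
  exact: lipschitz_abs_continuous (xlip i).
(* Countably many coefficients share one exceptional null set. *)
have aec : {ae (@lebesgue_measure R), forall t, forall k, `[0, T]%classic t ->
    cb i k t = riccati_coef p i k t}.
  by apply/ae_foralln => k; have [] := cP (i, k).
move=> dxi; apply: (@filterS2 _ _ (ae_filter_ringOfSetsType (@lebesgue_measure R))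
  _ _ _ _ dxi aec) => t dt ct tT.
have tT' : `[0, T]%classic t.
  by move: tT; rewrite /= !in_itv/= => /andP[h1 /ltW ->]; rewrite andbT; lra.
have := dt tT; rewrite /riccati_field.
suff -> : (fun k => cb i k t) = (fun k => riccati_coef p i k t) by [].
by apply/funext => k; exact: ct.
Qed.

Theorem mainTheorem3 (R : realType) (T : R) (S1 G : R) (p : riccati_data R)
  (T_gt0 : 0 < T) (theta_gt0 : 0 < theta p)
  (hA1 : bounded_measurable `[0, T] (A1 p))
  (hB1 : bounded_measurable `[0, T] (B1 p))
  (hD1 : bounded_measurable `[0, T] (D1 p))
  (hA2 : bounded_measurable `[0, T] (A2 p))
  (hB2 : bounded_measurable `[0, T] (B2 p))
  (hD2 : bounded_measurable `[0, T] (D2 p))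
  (hsigma : bounded_measurable `[0, T] (sigma p))
  (hR11 : bounded_measurable `[0, T] (R11 p))
  (hR12 : bounded_measurable `[0, T] (R12 p))
  (hR14 : bounded_measurable `[0, T] (R14 p))
  (hR22 : bounded_measurable `[0, T] (R22 p))
  (hR24 : bounded_measurable `[0, T] (R24 p))
  (hR44 : bounded_measurable `[0, T] (R44 p))
  (R44_unif_pos : exists2 delta : R, 0 < delta &
     forall t : R, t \in `[0, T] -> delta <= R44 p t) :
  exists eta : R,
    [/\ 0 < eta,
        [set` `[T - eta, T]] `<=` [set` `[0, T]]
      & exists alpha1 beta1 : R -> R,
          riccati_solution p S1 G (T - eta) T alpha1 beta1 /\
          forall alpha1' beta1' : R -> R,
            riccati_solution p S1 G (T - eta) T alpha1' beta1' ->
            forall t : R, t \in `[T - eta, T] ->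
              alpha1' t = alpha1 t /\ beta1' t = beta1 t].
Proof.
have hc := riccati_coef_bounded hA1 hB1 hD1 hA2 hB2 hD2 hsigma hR11 hR12 hR14
  hR22 hR24 hR44 R44_unif_pos.
have [eta /andP[eta0 etaT] [al [be sol]]] := riccati_exists S1 G T_gt0 hc.
exists eta; split => //.
  by apply: subset_itvr; rewrite bnd_simp subr_ge0.
exists al, be; split => // al' be' sol' t; rewrite in_itv/= => tab.
apply: (riccati_unique hc _ _ sol sol' tab); first by rewrite subr_ge0.
by rewrite lerBlDr lerDl ltW.
Qed.
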